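(* Let $m\ge 1$ with $m\equiv 0\pmod 4$, and let $\{P_0,\dots,P_m\}$ be a definite symmetric Clifford system on $\mathbb{R}^{2l}$ with $l-m-1\ge 1$. Let $F(x)=|x|^4-2\sum_{\alpha=0}^m\langle P_\alpha x,x\rangle^2$ and $M_-=\{x\in\mathbb{S}^{2l-1}: F(x)=-1\}$. Then any quadratic form $Q$ on $\mathbb{R}^{2l}$ vanishing on $M_-$ is identically zero. In particular, $M_-$ is not quadratic, and the positive semidefinite form $$G_F(x)=|x|^4-\sum_{\alpha=0}^m\langle P_\alpha x,x\rangle^2$$ is not a sum of squares of real polynomials.
   Context: A symmetric Clifford system on $\mathbb{R}^{2l}$ is a family of real symmetric $2l\times 2l$ matrices $P_0,\dots,P_m$ with $P_\alpha P_\beta+P_\beta P_\alpha=2\delta_{\alpha\beta}I_{2l}$ for all $\alpha,\beta$. It is called definite if $P_0P_1\cdots P_m=\pm I_{2l}$. The isoparametric polynomial $F$ of OT-FKM type has multiplicities $(m_+,m_-)=(m,l-m-1)$, both positive. A subset of the unit sphere is called quadratic if it is the intersection of the sphere with the common zero set of a family of real quadratic forms. *)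

(* Defs.v *)
From HB Require Import structures.
From mathcomp Require Import all_boot all_order all_algebra.
From mathcomp Require Import classical_sets reals.
From mathcomp Require Import mpoly.

Set Implicit Arguments.
Unset Strict Implicit.
Unset Printing Implicit Defensive.

Import Order.TTheory GRing.Theory Num.Theory.
Local Open Scope classical_set_scope.
Local Open Scope ring_scope.

Definition dot (S : comNzRingType) (n : nat) (u v : 'cV[S]_n) : S :=
  \sum_(i < n) u i 0 * v i 0.

Section Polynomials.

Variables (R : realType) (n : nat).

(* The vector x = (x_1, ..., x_n) of coordinate functions. *)
Definition coordX : 'cV[{mpoly R[n]}]_n := \col_(i < n) 'X_i.

(* The polynomial <A x, x>. *)
Definition qpoly (A : 'M[R]_n) : {mpoly R[n]} :=
  dot (map_mx (@mpolyC n R) A *m coordX) coordX.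

Definition evalv (p : {mpoly R[n]}) (x : 'cV[R]_n) : R := p.@[fun i => x i 0].

Definition unit_sphere : set 'cV[R]_n := [set x | dot x x = 1].

Definition quadratic_form (Q : {mpoly R[n]}) : Prop := Q \is 2.-homog.

(* A family of forms is given by the set of its members; it may be infinite
   or empty. *)
Definition quadratic_set (A : set 'cV[R]_n) : Prop :=
  exists2 Qs : set {mpoly R[n]},
    (forall Q, Qs Q -> quadratic_form Q) &
    A = unit_sphere `&` [set x | forall Q, Qs Q -> evalv Q x = 0].

Definition psd_form (d : nat) (p : {mpoly R[n]}) : Prop :=
  p \is d.-homog /\ forall x : 'cV[R]_n, 0 <= evalv p x.

Definition sum_of_squares (p : {mpoly R[n]}) : Prop :=
  exists s : seq {mpoly R[n]}, p = \sum_(q <- s) q ^+ 2.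

End Polynomials.

Arguments coordX {R n}.
Arguments unit_sphere : clear implicits.

Section Clifford.

Variables (R : realType) (m l : nat) (P : 'I_m.+1 -> 'M[R]_(2 * l)).

Definition symmetric_Clifford_system : Prop :=
  (forall a, (P a)^T = P a) /\
  (forall a b, P a *m P b + P b *m P a = (2 * (a == b)%:R)%:M).

Definition definite : Prop :=
  \prod_(a < m.+1) P a = 1%:M \/ \prod_(a < m.+1) P a = - 1%:M.

Definition OTFKM_F : {mpoly R[2 * l]} :=
  dot coordX coordX ^+ 2 - 2 * \sum_(a < m.+1) qpoly (P a) ^+ 2.

Definition M_minus : set 'cV[R]_(2 * l) :=
  unit_sphere R (2 * l) `&` [set x | evalv OTFKM_F x = -1].

Definition OTFKM_G : {mpoly R[2 * l]} :=
  dot coordX coordX ^+ 2 - \sum_(a < m.+1) qpoly (P a) ^+ 2.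

End Clifford.

(* Main.v *)
(* M_- contains every unit eigenvector of every P_a. So if <A x, x> vanishes on
   M_-, then (1 +- P_a) A (1 +- P_a) = 0, whence A anticommutes with each P_a;
   as m + 1 is odd it anticommutes with P_0 ... P_m = +-1, hence A = 0.
   M_- is not the whole sphere: take x in E_+(P_0), and y in E_-(P_0) orthogonal
   to all P_a x (possible since l > m); then G_F(x + y) = 4 |x|^2 |y|^2. Finally
   G_F vanishes on M_-, so in a representation G_F = sum q_i^2 the quadratic
   parts of the q_i vanish on M_-, hence are zero, and G_F would be zero. *)
Require Import Defs.
From mathcomp Require Import all_boot all_order all_algebra.
From mathcomp Require Import classical_sets reals.
From mathcomp Require Import mpoly.
From mathcomp Require Import zify ring lra.

Set Implicit Arguments.
Unset Strict Implicit.
Unset Printing Implicit Defensive.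

Import Order.TTheory GRing.Theory Num.Theory.
Local Open Scope ring_scope.

(* all_algebra also defines a [qpoly]. *)
Local Notation qpoly := Defs.qpoly.

(** * The scalar product and symmetric bilinear forms *)

Section Dot.

Variables (R : realType) (n : nat).
Implicit Types (u v w : 'cV[R]_n) (A : 'M[R]_n).

Lemma dotE u v : dot u v = (u^T *m v) 0 0.
Proof. by rewrite mxE; apply: eq_bigr => i _; rewrite mxE. Qed.

Lemma dotC u v : dot u v = dot v u.
Proof. by apply: eq_bigr => i _; rewrite mulrC. Qed.

Lemma dotDl u v w : dot (u + v) w = dot u w + dot v w.
Proof. by rewrite !dotE linearD mulmxDl mxE. Qed.

Lemma dotZl c u v : dot (c *: u) v = c * dot u v.
Proof. by rewrite !dotE linearZ -scalemxAl mxE. Qed.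

Lemma dotNl u v : dot (- u) v = - dot u v.
Proof. by rewrite -scaleN1r dotZl mulN1r. Qed.

Lemma dotDr u v w : dot w (u + v) = dot w u + dot w v.
Proof. by rewrite dotC dotDl !(dotC w). Qed.

Lemma dotZr c u v : dot u (c *: v) = c * dot u v.
Proof. by rewrite dotC dotZl dotC. Qed.

Lemma dotNr u v : dot u (- v) = - dot u v.
Proof. by rewrite dotC dotNl dotC. Qed.

Lemma dot0l v : dot 0 v = 0.
Proof. by rewrite -(scale0r 0) dotZl mul0r. Qed.

Lemma dot_mulmxl A u v : dot (A *m u) v = dot u (A^T *m v).
Proof. by rewrite !dotE trmx_mul mulmxA. Qed.

Lemma dot_ge0 u : 0 <= dot u u.
Proof. by apply: sumr_ge0 => i _; rewrite -expr2 sqr_ge0. Qed.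

Lemma dot_eq0 u : (dot u u == 0) = (u == 0).
Proof.
apply/eqP/eqP => [u0|->]; last exact: dot0l.
apply/colP => i; rewrite mxE; apply/eqP; rewrite -sqrf_eq0 expr2; apply/eqP.
by move: i isT; apply: psumr_eq0P => // i _; rewrite -expr2 sqr_ge0.
Qed.

Lemma dot_gt0 u : (0 < dot u u) = (u != 0).
Proof. by rewrite lt0r dot_eq0 dot_ge0 andbT. Qed.

Lemma dot_suml (I : finType) (F : I -> 'cV[R]_n) v :
  dot (\sum_i F i) v = \sum_i dot (F i) v.
Proof.
by elim/big_rec2: _ => [|i a u _ <-]; rewrite ?dot0l ?dotDl.
Qed.

Lemma exists_unit_multiple u : u != 0 ->
  exists2 c, c != 0 & dot (c *: u) (c *: u) = 1.
Proof.
rewrite -dot_gt0 => u0; exists (Num.sqrt (dot u u))^-1.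
  by rewrite invr_eq0 gt_eqF // sqrtr_gt0.
rewrite dotZl dotZr mulrA -expr2 exprVn sqr_sqrtr ?ltW //.
by rewrite mulVf // gt_eqF.
Qed.

(** Evaluating the form at [x + A *m x] leaves, by symmetry, only the two cross terms, each equal to
    |A x|^2. *)
Lemma sym_form_eq0 A :
  A^T = A -> (forall x, dot (A *m x) x = 0) -> A = 0.
Proof.
move=> symA A0.
have A0' (x : 'cV[R]_n) : A *m x = 0.
  apply/eqP; rewrite -dot_eq0; apply/eqP.
  have := A0 (x + A *m x).
  rewrite mulmxDr !(dotDl, dotDr) !A0 (dot_mulmxl A (A *m x)) symA.
  by move=> h; lra.
apply/matrixP => i j; have /colP/(_ i) := A0' (delta_mx j 0).
by rewrite -colE !mxE.
Qed.

End Dot.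

(** * Quadratic forms as symmetric matrices; restriction of polynomials to rays *)

Section Polynomials.

Variables (R : realType) (n : nat).
Implicit Types (x : 'cV[R]_n) (A : 'M[R]_n) (p q Q : {mpoly R[n]}).

Lemma evalv_sqnorm x : evalv (dot coordX coordX) x = dot x x.
Proof.
rewrite /evalv /dot raddf_sum; apply: eq_bigr => i _ /=.
by rewrite mevalM !mxE mevalXU.
Qed.

Lemma qpolyE A :
  qpoly A = \sum_(i < n) \sum_(j < n) A i j *: ('X_j * 'X_i).
Proof.
apply: eq_bigr => i _; rewrite !mxE mulr_suml; apply: eq_bigr => j _.
by rewrite !mxE -mul_mpolyC mulrA.
Qed.

Lemma qpolyD A B : qpoly (A + B) = qpoly A + qpoly B.
Proof.
rewrite !qpolyE -big_split; apply: eq_bigr => i _.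
by rewrite -big_split; apply: eq_bigr => j _; rewrite mxE scalerDl.
Qed.

Lemma qpolyZ c A : qpoly (c *: A) = c *: qpoly A.
Proof.
rewrite !qpolyE scaler_sumr; apply: eq_bigr => i _.
by rewrite scaler_sumr; apply: eq_bigr => j _; rewrite mxE scalerA.
Qed.

Lemma qpoly0 : qpoly (0 : 'M[R]_n) = 0.
Proof. by rewrite -(scale0r (0 : 'M[R]_n)) qpolyZ scale0r. Qed.

Lemma qpoly_tr A : qpoly A^T = qpoly A.
Proof.
rewrite !qpolyE exchange_big; apply: eq_bigr => i _; apply: eq_bigr => j _.
by rewrite mxE mulrC.
Qed.

Lemma qpoly_delta i j : qpoly (delta_mx i j : 'M[R]_n) = 'X_j * 'X_i.
Proof.
rewrite qpolyE (bigD1 i) //= (bigD1 j) //= mxE !eqxx scale1r.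
rewrite big1 => [|k /negPf jk]; last by rewrite mxE jk andbF scale0r.
rewrite big1 ?addr0 // => k /negPf ik; rewrite big1 // => k' _.
by rewrite mxE ik scale0r.
Qed.

Lemma evalv_qpoly A x : evalv (qpoly A) x = dot (A *m x) x.
Proof.
rewrite qpolyE /evalv raddf_sum; apply: eq_bigr => i _.
rewrite !mxE mulr_suml raddf_sum; apply: eq_bigr => j _ /=.
by rewrite mevalZ mevalM !mevalXU mulrA.
Qed.

Lemma qpoly_homog A : qpoly A \is 2.-homog.
Proof.
rewrite qpolyE; apply: rpred_sum => i _; apply: rpred_sum => j _.
by apply: dhomogZ; rewrite -mpolyXD dhomogX /= mdegD !mdeg1.
Qed.

Lemma quadratic_form_qpoly Q :
  quadratic_form Q -> exists2 A : 'M[R]_n, A^T = A & Q = qpoly A.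
Proof.
move=> /dhomogP homQ.
suff [A ->] : exists A, Q = qpoly A.
  (* [qpoly] sees only the symmetric part of a matrix. *)
  exists (2^-1 *: (A + A^T)).
    by rewrite linearZ linearD /= trmxK addrC.
  rewrite qpolyZ qpolyD qpoly_tr -mulr2n -scaler_nat scalerA.
  by rewrite mulVf ?pnatr_eq0 // scale1r.
rewrite [Q]mpolyE big_seq.
elim/big_ind: _ => [|p q [A ->] [B ->]|m mQ].
- by exists 0; rewrite qpoly0.
- by exists (A + B); rewrite qpolyD.
have deg_m : mdeg m = 2 := homQ m mQ.
(* Split off one variable ['X_i] dividing the monomial; the quotient has degree 1, so it is a single
   ['X_j]. *)
have [/existsP[i mi]|/existsPn m0] := boolP [exists i, m i != 0%N]; last first.
  suff m_eq0 : m = 0%MM by rewrite m_eq0 mdeg0 in deg_m.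
  by apply/mnmP => i; rewrite mnm0E; apply/eqP/negPn/m0.
have le_im : (U_(i) <= m)%MM by rewrite lep1mP.
have : mdeg (m - U_(i)) == 1%N.
  by rewrite -(eqn_add2r (mdeg U_(i))) -mdegD submK // deg_m mdeg1.
rewrite mdeg_eq1 => /existsP[j /eqP mj].
exists (Q@_m *: delta_mx i j); rewrite qpolyZ qpoly_delta -mpolyXD -mj.
by rewrite submK.
Qed.

(** The [mmap] substitutes t x for the variables, giving p(t x) as a polynomial in t; a monomial of
    degree d contributes to t^d only. *)
Lemma coef_mmap_ray p x d :
  (mmap polyC (fun i => x i 0 *: 'X) p)`_d = evalv (pihomog mdeg d p) x.
Proof.
rewrite /evalv pihomogE raddf_sum /mmap coef_sum big_mkcond /=.
rewrite [RHS]big_mkcond /=.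
apply: eq_bigr => m _; rewrite coefCM mevalZ mevalX.
have -> : mmap1 (fun i => x i 0 *: 'X) m
    = (\prod_(i < n) x i 0 ^+ m i) *: 'X^(mdeg m).
  rewrite /mmap1 mdegE -prodrXr -scaler_prod.
  by apply: eq_bigr => i _; rewrite exprZn.
rewrite coefZ coefXn [d == _]eq_sym.
by case: eqP; rewrite ?mulr1 ?mulr0.
Qed.

Lemma homog_ray p d x :
  p \is d.-homog ->
  mmap polyC (fun i => x i 0 *: 'X) p = evalv p x *: 'X^d.
Proof.
move=> homp; apply/polyP => e; rewrite coef_mmap_ray coefZ coefXn.
have [->|/negPf ne] := eqVneq e d; first by rewrite pihomog_dE ?mulr1.
by rewrite (pihomog_ne0 _ homp) ?mulr0 ?[d == _]eq_sym ?ne // /evalv meval0.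
Qed.

End Polynomials.

(** * Sums of squares in one variable and along rays *)

Lemma sqr_sum_eq0 (R : realDomainType) (s : seq R) :
  \sum_(a <- s) a ^+ 2 = 0 -> forall a, a \in s -> a = 0.
Proof.
move=> s0 a sa; apply/eqP; rewrite -sqrf_eq0; move: s0 => /eqP.
rewrite psumr_eq0 => [/allP/(_ _ sa) //|b _]; exact: sqr_ge0.
Qed.

(** The vanishing coefficient of t^0 kills all constant terms, then that of t^2 kills all linear
    terms; after that each square contributes only its squared t^2 coefficient to t^4. *)
Lemma sos_monomial4 (R : realDomainType) (s : seq {poly R}) (c : R) :
  \sum_(r <- s) r ^+ 2 = c *: 'X^4 -> c = \sum_(r <- s) r`_2 ^+ 2.
Proof.
move=> sE.
have coefs k : \sum_(r <- s) (r ^+ 2)`_k = c * (k == 4%N)%:R.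
  by rewrite -coef_sum sE coefZ coefXn.
have r0 r : r \in s -> r`_0 = 0.
  move=> sr; apply: (@sqr_sum_eq0 _ [seq r`_0 | r : {poly R} <- s]);
    last exact: map_f.
  rewrite big_map -[RHS](mulr0 c) -(coefs 0%N); apply: eq_bigr => q _.
  by rewrite expr2 coef0M.
have r1 r : r \in s -> r`_1 = 0.
  move=> sr; apply: (@sqr_sum_eq0 _ [seq r`_1 | r : {poly R} <- s]);
    last exact: map_f.
  rewrite big_map -[RHS](mulr0 c) -(coefs 2%N) big_seq [RHS]big_seq.
  apply: eq_bigr => q sq; rewrite [in RHS]expr2 coefM !big_ord_recl big_ord0 /=.
  by rewrite r0 // !(mul0r, mulr0, addr0, add0r) expr2.
rewrite -[LHS]mulr1 -(coefs 4%N) big_seq [RHS]big_seq.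
apply: eq_bigr => q sq; rewrite [in LHS]expr2 coefM !big_ord_recl big_ord0 /=.
by rewrite r0 // r1 // !(mul0r, mulr0, addr0, add0r) expr2.
Qed.

(* Restricting to the ray t |-> t x gives sum_i q_i(t x)^2 = p(x) t^4, which
   forces q_i(t x) = O(t^2); compare the coefficients of t^4. *)
Lemma sos_quartic_pihomog (R : realType) (n : nat) (p : {mpoly R[n]}) s x :
  p \is 4.-homog -> p = \sum_(q <- s) q ^+ 2 ->
  evalv p x = \sum_(q <- s) evalv (pihomog mdeg 2 q) x ^+ 2.
Proof.
move=> homp pE; pose ray := mmap polyC (fun i => x i 0 *: 'X).
have rayE : \sum_(r <- map ray s) r ^+ 2 = evalv p x *: 'X^4.
  rewrite -homog_ray // pE raddf_sum big_map; apply: eq_bigr => q _.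
  by rewrite /= /ray rmorphXn.
rewrite (sos_monomial4 rayE) big_map; apply: eq_bigr => q _.
by rewrite coef_mmap_ray.
Qed.

(** * Clifford systems, their eigenvectors, and nonnegativity of G_F *)

Section Clifford.

Variables (R : realType) (m l : nat) (P : 'I_m.+1 -> 'M[R]_(2 * l)).
Hypothesis P_Clifford : symmetric_Clifford_system P.
Implicit Types (x y z : 'cV[R]_(2 * l)) (a b : 'I_m.+1).

Let P_sym a : (P a)^T = P a.
Proof. by case: P_Clifford. Qed.

Lemma Clifford_sqr a : P a *m P a = 1%:M.
Proof.
have := P_Clifford.2 a a; rewrite eqxx mulr1 -mulr2n => /matrixP P2.
apply/matrixP => i j; have := P2 i j; rewrite !mxE.
by case: (i == j) => /=; lra.
Qed.

Lemma Clifford_anticomm a b : a != b -> P a *m P b = - (P b *m P a).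
Proof.
move=> /negPf ab; apply/eqP; rewrite -addr_eq0; apply/eqP.
by rewrite P_Clifford.2 ab mulr0 raddf0.
Qed.

Definition clifford_sum x := \sum_a dot (P a *m x) x ^+ 2.

Lemma evalv_sum_sqr_qpoly x :
  evalv (\sum_a qpoly (P a) ^+ 2) x = clifford_sum x.
Proof.
rewrite /evalv raddf_sum; apply: eq_bigr => a _ /=.
by rewrite rmorphXn -evalv_qpoly.
Qed.

Lemma evalv_F x : evalv (OTFKM_F P) x = dot x x ^+ 2 - 2 * clifford_sum x.
Proof.
rewrite -evalv_sum_sqr_qpoly -evalv_sqnorm /evalv /OTFKM_F mevalB.
by rewrite !mulr_natl mevalMn rmorphXn.
Qed.

Lemma evalv_G x : evalv (OTFKM_G P) x = dot x x ^+ 2 - clifford_sum x.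
Proof.
rewrite -evalv_sum_sqr_qpoly -evalv_sqnorm /evalv /OTFKM_G mevalB.
by rewrite rmorphXn.
Qed.

Lemma evalv_GZ c x : evalv (OTFKM_G P) (c *: x) = c ^+ 4 * evalv (OTFKM_G P) x.
Proof.
rewrite !evalv_G dotZl dotZr mulrBr; congr (_ - _); first by ring.
rewrite /clifford_sum mulr_sumr; apply: eq_bigr => a _.
by rewrite -scalemxAr dotZl dotZr; ring.
Qed.

(** On the unit sphere F = 1 - 2 s with s = [clifford_sum x]. In this form it is plain that G_F = 1
    - s vanishes on M_-. *)
Lemma M_minusE x : M_minus P x <-> dot x x = 1 /\ clifford_sum x = 1.
Proof.
rewrite /M_minus /unit_sphere /=.
by split=> -[x1]; rewrite /= evalv_F x1 expr1n => h; split=> //; lra.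
Qed.

(** [P b] anticommutes with [P a], so it sends the e-eigenspace of [P a] into the (-e)-eigenspace,
    which is orthogonal to it. *)
Lemma eigen_orth a b e x : e ^+ 2 = 1 -> P a *m x = e *: x -> b != a ->
  dot (P b *m x) x = 0.
Proof.
move=> e1 Pax ba; have e0 : e != 0 by rewrite -sqrf_eq0 e1 oner_neq0.
have : dot (P b *m x) (P a *m x) = - dot (P b *m x) (P a *m x).
  rewrite -{1}[P a]P_sym -dot_mulmxl mulmxA Clifford_anticomm 1?eq_sym //.
  by rewrite mulNmx dotNl -mulmxA Pax -scalemxAr dotZl dotZr.
rewrite Pax dotZr => h; apply: (mulfI e0); rewrite mulr0; lra.
Qed.

Lemma clifford_sum_eigen a e x : e ^+ 2 = 1 -> P a *m x = e *: x ->
  clifford_sum x = dot x x ^+ 2.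
Proof.
move=> e1 Pax; rewrite /clifford_sum (bigD1 a) //= big1 => [|b ba].
  by rewrite addr0 Pax dotZl exprMn e1 mul1r.
by rewrite (eigen_orth e1 Pax) ?expr0n.
Qed.

Lemma eigen_M_minus a e x : e ^+ 2 = 1 -> P a *m x = e *: x -> dot x x = 1 ->
  M_minus P x.
Proof.
move=> e1 Pax x1; apply/M_minusE.
by rewrite (clifford_sum_eigen e1 Pax) x1 expr1n.
Qed.

(* With M := sum_a <P_a x, x> P_a one has M^2 = s, where s = clifford_sum x, and
   <M x, x> = s; expand | |x|^2 x - M x |^2. *)
Lemma clifford_sum_le x : clifford_sum x <= dot x x ^+ 2.
Proof.
pose c a := dot (P a *m x) x; pose Mx := \sum_a c a *: (P a *m x).
have Mxx : dot Mx x = clifford_sum x.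
  by rewrite dot_suml; apply: eq_bigr => a _; rewrite dotZl expr2.
have MxMx : dot Mx Mx = clifford_sum x * dot x x.
  have Msqr : \sum_a \sum_b (c a * c b) *: (P a *m P b) = (clifford_sum x)%:M.
    set S := LHS.
    (* Adding the double sum with its indices exchanged produces the anticommutators, and only the
       terms a = b survive. *)
    have S2 : S + S = (clifford_sum x *+ 2)%:M.
      rewrite {2}/S exchange_big -big_split /=.
      under eq_bigr => a _ do rewrite -big_split /=.
      under eq_bigr => a _ do under eq_bigr => b _ do
        rewrite [c b * c a]mulrC -scalerDr P_Clifford.2.
      rewrite /clifford_sum -sumrMnl raddf_sum; apply: eq_bigr => a _.
      rewrite (bigD1 a) //= eqxx big1 => [|b /negPf ba]; last first.
        by rewrite eq_sym ba mulr0 raddf0 scaler0.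
      rewrite addr0 scale_scalar_mx -/(c a); congr (_%:M).
      by rewrite mulr1; ring.
    apply/matrixP => i j; have /matrixP/(_ i j) := S2; rewrite !mxE.
    by case: (i == j) => /=; lra.
  rewrite dot_suml.
  under eq_bigr => a _ do rewrite dotC dot_suml.
  transitivity (dot ((clifford_sum x)%:M *m x) x); last first.
    by rewrite mul_scalar_mx dotZl.
  rewrite -Msqr mulmx_suml dot_suml; apply: eq_bigr => a _.
  rewrite mulmx_suml dot_suml; apply: eq_bigr => b _.
  rewrite dotZl dotZr -scalemxAl dotZl -mulmxA (dot_mulmxl (P a)) P_sym.
  by rewrite mulrCA mulrA.
have := dot_ge0 (dot x x *: x - Mx).
rewrite !(dotDl, dotDr, dotNl, dotNr, dotZl, dotZr) (dotC x) Mxx MxMx.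
(* The expanded square is |x|^2 (|x|^4 - s), so for nonzero x the factor |x|^2 can be cancelled. *)
have [->|x0] := eqVneq x 0.
  rewrite /clifford_sum big1 => [|a _]; first by rewrite sqr_ge0.
  by rewrite mulmx0 dot0l expr0n.
rewrite -dot_gt0 in x0 => h.
rewrite -subr_ge0 -(pmulr_rge0 _ x0).
by move: h; congr (0 <= _); ring.
Qed.

Lemma G_homog : OTFKM_G P \is 4.-homog.
Proof.
have sqr_homog (p : {mpoly R[2 * l]}) : p \is 2.-homog -> p ^+ 2 \is 4.-homog.
  by move=> homp; rewrite expr2; apply: (dhomogM homp homp).
apply: rpredB; last by apply: rpred_sum => a _; apply/sqr_homog/qpoly_homog.
apply/sqr_homog/rpred_sum => i _.
by rewrite mxE -mpolyXD dhomogX /= mdegD !mdeg1.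
Qed.

Lemma G_psd : psd_form 4 (OTFKM_G P).
Proof.
split; first exact: G_homog.
by move=> x; rewrite evalv_G subr_ge0 clifford_sum_le.
Qed.

(** * Quadratic forms vanishing on M_- *)

Lemma eigen_form_eq0 (A : 'M[R]_(2 * l)) a e x :
  (forall x, M_minus P x -> evalv (qpoly A) x = 0) ->
  e ^+ 2 = 1 -> P a *m x = e *: x -> dot (A *m x) x = 0.
Proof.
move=> QA e1 Pax; have [->|x0] := eqVneq x 0; first by rewrite mulmx0 dot0l.
have [c c0 cx1] := exists_unit_multiple x0.
have : dot (A *m (c *: x)) (c *: x) = 0.
  rewrite -evalv_qpoly; apply/QA/(@eigen_M_minus a e) => //.
  by rewrite -scalemxAr Pax !scalerA mulrC.
by rewrite -scalemxAr dotZl dotZr => /eqP; rewrite !mulf_eq0 (negPf c0) => /eqP.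
Qed.

Lemma vanishing_anticomm (A : 'M[R]_(2 * l)) a :
  A^T = A -> (forall x, M_minus P x -> evalv (qpoly A) x = 0) ->
  A *m P a = - (P a *m A).
Proof.
move=> symA QA.
have sandwich e : e ^+ 2 = 1 ->
    (1%:M + e *: P a) *m A *m (1%:M + e *: P a) = 0.
  move=> e1; apply: sym_form_eq0 => [|x].
    by rewrite !trmx_mul linearD linearZ /= trmx1 P_sym symA mulmxA.
  rewrite -mulmxA -mulmxA dot_mulmxl linearD linearZ /= trmx1 P_sym.
  (* Since [P a] squares to 1, the image of 1 + e P_a consists of e-eigenvectors of [P a]. *)
  apply: (eigen_form_eq0 (a := a) QA e1).
  rewrite mulmxA mulmxDr -scalemxAr Clifford_sqr mulmx1.
  by rewrite scalemxAl scalerDr scalerA -expr2 e1 scale1r addrC.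
(* The difference of the two sandwiches is 2 (A P_a + P_a A). *)
have := sandwich 1 (expr1n _ _); have := sandwich (-1) (sqrr_sign _ 1).
rewrite scaleN1r scale1r !(mulmxDl, mulmxDr) !(mul1mx, mulmx1, mulNmx, mulmxN).
move=> /matrixP hm /matrixP hp; apply/matrixP => i j.
have := hm i j; have := hp i j; rewrite !mxE; lra.
Qed.

Lemma vanishing_form_eq0 (Q : {mpoly R[2 * l]}) : ~~ odd m -> definite P ->
  quadratic_form Q -> (forall x, M_minus P x -> evalv Q x = 0) -> Q = 0.
Proof.
move=> m_even P_def /quadratic_form_qpoly[A symA ->] QA.
suff -> : A = 0 by rewrite qpoly0.
have anti a := vanishing_anticomm a symA QA.
have prod_anti : A *m (\prod_a P a) = - ((\prod_a P a) *m A).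
  have sign s : A *m (\prod_(a <- s) P a)
      = (-1) ^+ size s *: ((\prod_(a <- s) P a) *m A).
    elim: s => [|a s IHs] /=.
      by rewrite big_nil expr0 scale1r mulmx1 mul1mx.
    rewrite big_cons; move: IHs; set X := \prod_(a <- s) _ => IHs.
    rewrite -mulmxE mulmxA anti mulNmx -(mulmxA _ A) IHs.
    by rewrite exprS mulN1r scaleNr -scalemxAr mulmxA.
  (* There are m + 1 factors, an odd number, so the sign is -1. *)
  rewrite sign -[index_enum _]enumT -cardE card_ord -signr_odd /= m_even.
  by rewrite expr1 scaleN1r.
have A2 : A = - A.
  case: P_def => E; move: prod_anti; rewrite E ?mulmxN ?mulNmx mulmx1 mul1mx //.
  by move=> ->; rewrite opprK.
by apply/matrixP => i j; have /matrixP/(_ i j) := A2; rewrite !mxE; lra.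
Qed.

Lemma exists_G_neq0 : (1 <= m)%N -> (1 <= l - m - 1)%N ->
  exists z, evalv (OTFKM_G P) z != 0.
Proof.
move=> m_gt0 l_ge; pose o : 'I_m.+1 := ord_max.
pose Dp := 1%:M + P ord0; pose Dm := 1%:M - P ord0.
(* As m is positive, [o] differs from [ord0]; the invertible [P o] intertwines [Dp] and [Dm], so
   they have equal rank. Their sum is twice the identity, so this rank is at least l. *)
have conj : P o *m Dp = Dm *m P o.
  rewrite mulmxDr mulmxBl mul1mx mulmx1 Clifford_anticomm //.
  by rewrite -val_eqE /= -lt0n.
have Po_unit : P o \in unitmx by case/mulmx1_unit: (Clifford_sqr o).
have rank_eq : \rank Dp = \rank Dm.
  rewrite -[RHS](mxrankMfree _ (B := P o)) ?row_free_unit // -conj.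
  by rewrite eqmxMfull // row_full_unit.
have rank_ge : (l <= \rank Dm)%N.
  have DpDm : Dp + Dm = 2 *: 1%:M.
    by rewrite addrACA subrr addr0 scaler_nat.
  have := mxrank_add Dp Dm; rewrite DpDm mxrank_scale_nz ?pnatr_eq0 // mxrank1.
  by rewrite rank_eq addnn -mul2n leq_pmul2l.
have l_gt : (m.+1 < l)%N by lia.
have DmP (y : 'cV[R]_(2 * l)) : P ord0 *m (Dm *m y) = - (Dm *m y).
  by rewrite mulmxA mulmxBr mulmx1 Clifford_sqr -mulNmx opprB.
have DpP (y : 'cV[R]_(2 * l)) : P ord0 *m (Dp *m y) = Dp *m y.
  by rewrite mulmxA mulmxDr mulmx1 Clifford_sqr addrC.
have [x x0 Px] : exists2 x : 'cV[R]_(2 * l), x != 0 & P ord0 *m x = x.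
  have : Dp != 0 by rewrite -mxrank_eq0 rank_eq; lia.
  move=> /eqP Dp0.
  have [/existsP[j colj]|/existsPn Dp_col] := boolP [exists j, col j Dp != 0];
    last first.
    case: Dp0; apply/matrixP => i j.
    by have /negPn/eqP/colP/(_ i) := Dp_col j; rewrite !mxE.
  by exists (col j Dp) => //; rewrite colE DpP.
pose W : 'M[R]_(2 * l, m.+1) := \matrix_(i, a) (P a *m x) i 0.
have [y [y0 Py y_orth]] : exists y : 'cV[R]_(2 * l),
    [/\ y != 0, P ord0 *m y = - y & forall a, dot (P a *m x) y = 0].
  (* Otherwise [Dm] would have rank at most that of [Dm *m W], hence at most m + 1 < l. A row v in
     the first kernel but not in the second gives y = (v Dm)^T: nonzero, in E_-(P_0), and orthogonal
     to the columns P_a x of [W]. *)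
  have : ~~ (kermx (Dm *m W) <= kermx Dm)%MS.
    apply: contraTN rank_ge => /mxrankS; rewrite !mxrank_ker.
    rewrite leq_sub2lE ?rank_leq_row // -ltnNge => /leq_ltn_trans; apply.
    apply: leq_ltn_trans l_gt.
    exact: leq_trans (mxrankM_maxr Dm W) (rank_leq_col W).
  case/row_subPn => i; set v := row i _ => vD.
  have vDW : v *m (Dm *m W) = 0.
    by apply/sub_kermxP; rewrite row_sub.
  exists (v *m Dm)^T; split.
  - by rewrite -trmx0 (inj_eq trmx_inj); apply: contra vD => /eqP/sub_kermxP.
  - rewrite trmx_mul linearB /= trmx1 P_sym; exact: DmP.
  move: vDW; rewrite mulmxA => vDW a; rewrite dotC dotE trmxK mxE.
  have /matrixP/(_ 0 a) := vDW; rewrite mxE [X in _ = X]mxE => {vDW} vDW.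
  by rewrite -[RHS]vDW; apply: eq_bigr => k _; rewrite [W _ _]mxE.
exists (x + y); rewrite evalv_G.
have xy : dot x y = 0 by rewrite -Px y_orth.
(* The cross terms vanish by the choice of y. For a other than 0 so do the diagonal ones, by
   [eigen_orth]; a = 0 leaves |x|^2 - |y|^2. *)
have sumE : clifford_sum (x + y) = (dot x x - dot y y) ^+ 2.
  have Pz a : dot (P a *m (x + y)) (x + y) =
      dot (P a *m x) x + dot (P a *m y) y.
    rewrite mulmxDr !(dotDl, dotDr) y_orth (dot_mulmxl _ y x) P_sym.
    by rewrite (dotC y) y_orth addr0 add0r.
  rewrite /clifford_sum (bigD1 ord0) //= big1 => [|a a0].
    by rewrite addr0 Pz Px Py dotNl.
  rewrite Pz (eigen_orth (expr1n _ 2) (etrans Px (esym (scale1r x)))) //.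
  rewrite (eigen_orth (sqrr_sign _ 1) (etrans Py (esym (scaleN1r y)))) //.
  by rewrite addr0 expr0n.
rewrite sumE !(dotDl, dotDr) xy (dotC y) xy.
have -> : (dot x x + 0 + (0 + dot y y)) ^+ 2 - (dot x x - dot y y) ^+ 2
   = 4 * (dot x x * dot y y) by ring.
by rewrite !mulf_neq0 ?dot_eq0 ?pnatr_eq0.
Qed.

End Clifford.

(** * Consequences for M_- and G_F *)

Theorem theorem4p2 (R : realType) (m l : nat) (P : 'I_m.+1 -> 'M[R]_(2 * l))
    (m_ge1 : (1 <= m)%N) (m_mod4 : m = 0 %[mod 4])
    (l_ge : (1 <= l - m - 1)%N)
    (P_Clifford : symmetric_Clifford_system P) (P_definite : definite P) :
  (forall Q : {mpoly R[2 * l]}, quadratic_form Q ->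
     (forall x, M_minus P x -> evalv Q x = 0) -> Q = 0) /\
  ~ quadratic_set (M_minus P) /\
  psd_form 4 (OTFKM_G P) /\
  ~ sum_of_squares (OTFKM_G P).
Proof.
have m_even : ~~ odd m.
  by rewrite -dvdn2 /= (@dvdn_trans 4) // /dvdn m_mod4 mod0n.
have no_form := vanishing_form_eq0 P_Clifford m_even P_definite.
have [z Gz] := exists_G_neq0 P_Clifford m_ge1 l_ge.
split; first exact: no_form; split; last split; last 1 first.
- move=> [s sE]; move: Gz.
  have GE y := sos_quartic_pihomog y (G_homog P) sE.
  (* At a point of M_- the squares of the quadratic parts sum to G_F = 0, so every quadratic part
     vanishes on M_-. *)
  have q2 q : q \in s -> pihomog mdeg 2 q = 0.
    move=> sq; apply: no_form => [|x /M_minusE[x1 Sx]].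
      exact: pihomogP.
    apply: (@sqr_sum_eq0 _ [seq evalv (pihomog mdeg 2 r) x | r <- s]).
      by rewrite big_map -GE evalv_G x1 Sx expr1n subrr.
    exact: (map_f (fun r => evalv (pihomog mdeg 2 r) x)).
  rewrite GE big_seq big1 ?eqxx // => q sq.
  by rewrite q2 // /evalv meval0 expr0n.
(* All defining forms vanish on M_-, hence are zero, so M_- would be the whole sphere. But G_F
   vanishes on M_- and not at the normalised [z]. *)
- move=> [Qs Qs2 ME].
  have z0 : z != 0.
    by apply: contraNneq Gz => ->; rewrite -(scale0r z) evalv_GZ expr0n mul0r.
  have [c c0 cz1] := exists_unit_multiple z0.
  have [] : M_minus P (c *: z) /\ evalv (OTFKM_G P) (c *: z) != 0.
    split; last by rewrite evalv_GZ mulf_neq0 ?expf_neq0.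
    rewrite ME; split=> // Q QsQ; rewrite (no_form Q) ?/evalv ?meval0 //.
      exact: Qs2.
    by move=> x; rewrite ME => -[_]; apply.
  by case/M_minusE => _ Scz; rewrite evalv_G cz1 Scz expr1n subrr eqxx.
exact: G_psd.
Qed.
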